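(* Let $K,L$ be convex bodies in $\mathbb{R}^3$ such that each of $K,L$ has countably many diameters and these have the same length, i.e. $\max_{\theta\in S^2}\omega_K(\theta)=\max_{\theta\in S^2}\omega_L(\theta)$ and, for each of the two bodies, the maximum is attained at a countable set of directions. Assume that there exists a diameter $d_K(\xi_0)$ of $K$, parallel to a direction $\xi_0\in S^2$, such that for every unit vector $w\in\xi_0^\perp$ there exists $\varphi_w\in SO(2,w^\perp)$ with $\varphi_w(K|w^\perp)\subseteq L|w^\perp$. If either $K$ or $L$ is origin-symmetric, then $K\subseteq L$.
   Context: A convex body is a compact convex set with non-empty interior. The support function of a convex body $K$ is $h_K(x)=\max\{x\cdot y: y\in K\}$, and its width function is $\omega_K(x)=h_K(x)+h_K(-x)$ for $x\in S^2$. A segment $[z,y]\subset K$ is a diameter of $K$ if $|z-y|=\max_{\theta\in S^2}\omega_K(\theta)$; a convex body has at most one diameter parallel to a given direction $\zeta\in S^2$, denoted $d_K(\zeta)$ when it exists. For a unit vector $w$, $w^\perp=\{x\in\mathbb{R}^3: x\cdot w=0\}$, $K|w^\perp$ is the orthogonal projection of $K$ onto $w^\perp$, and $SO(2,w^\perp)$ is the group of rotations of the plane $w^\perp$ around the origin. Origin-symmetric means $K=-K$. Countable includes finite. *)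

(* Defs.v *)
From mathcomp Require Import all_boot all_order all_algebra.
From mathcomp Require Import all_classical all_reals all_analysis.

Set Implicit Arguments.
Unset Strict Implicit.
Unset Printing Implicit Defensive.

Import Order.TTheory GRing.Theory Num.Theory.
Import numFieldNormedType.Exports.

Local Open Scope classical_set_scope.
Local Open Scope ring_scope.

(* The library norm `|x| on 'rV[R]_n is the sup norm: it is
   used only through the topology it induces, and lengths are measured with
   the Euclidean norm [enorm]. *)

Definition dot (R : realType) (n : nat) (x y : 'rV[R]_n) : R :=
  \sum_(i < n) x 0 i * y 0 i.

Definition enorm (R : realType) (n : nat) (x : 'rV[R]_n) : R :=
  Num.sqrt (dot x x).

Definition sphere (R : realType) (n : nat) : set 'rV[R]_n :=
  [set x | enorm x = 1].

Definition convex_body (R : realType) (n : nat) (K : set 'rV[R]_n) : Prop :=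
  [/\ compact K, convex_set K & K° !=set0].

Definition origin_symmetric (R : realType) (n : nat) (K : set 'rV[R]_n) :
    Prop :=
  K = [set - x | x in K].

(* For a convex body, the suprema in [support_fun] and [max_width] are attained
   maxima, by compactness of K and of the unit sphere. *)
Definition support_fun (R : realType) (n : nat) (K : set 'rV[R]_n)
    (x : 'rV[R]_n) : R :=
  sup [set dot x y | y in K].

Definition width (R : realType) (n : nat) (K : set 'rV[R]_n)
    (x : 'rV[R]_n) : R :=
  support_fun K x + support_fun K (- x).

Definition max_width (R : realType) (n : nat) (K : set 'rV[R]_n) : R :=
  sup [set width K t | t in @sphere R n].

Definition segment (R : realType) (n : nat) (z y : 'rV[R]_n) : set 'rV[R]_n :=
  [set (1 - t) *: z + t *: y | t in [set t : R | 0 <= t <= 1]].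

Definition is_diameter (R : realType) (n : nat) (K : set 'rV[R]_n)
    (z y : 'rV[R]_n) : Prop :=
  segment z y `<=` K /\ enorm (z - y) = max_width K.

(* Both t and - t belong to this set when K has a diameter parallel to t. *)
Definition diameter_directions (R : realType) (n : nat) (K : set 'rV[R]_n) :
    set 'rV[R]_n :=
  [set t | sphere t /\ width K t = max_width K].

Definition parallel (R : realType) (n : nat) (v xi : 'rV[R]_n) : Prop :=
  exists c : R, v = c *: xi.

(* K | w^perp, as a subset of the ambient space, for a unit vector w. *)
Definition projection (R : realType) (n : nat) (K : set 'rV[R]_n)
    (w : 'rV[R]_n) : set 'rV[R]_n :=
  [set x - dot x w *: w | x in K].

(* SO(2, w^perp): a rotation of the plane w^perp about the origin is encoded by
   its extension to the ambient space by the identity on the line spanned by w,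
   i.e. by a special orthogonal matrix fixing w; it acts by x |-> x *m A. *)
Definition SO2 (R : realType) (w : 'rV[R]_3) : set 'M[R]_3 :=
  [set A | [/\ A *m A^T = 1%:M, \det A = 1 & w *m A = w]].

(* Main.v *)
Require Import Defs.
From mathcomp Require Import all_boot all_order all_algebra.
From mathcomp Require Import all_classical all_reals all_analysis.
From mathcomp Require Import ring lra.

Set Implicit Arguments.
Unset Strict Implicit.
Unset Printing Implicit Defensive.

Import Order.TTheory GRing.Theory Num.Theory.
Import numFieldNormedType.Exports.

Local Open Scope classical_set_scope.
Local Open Scope ring_scope.

(** For a unit [w] orthogonal to [xi0], the rotated shadow of the diameter
    [d_K(xi0)] lies in [L | w^perp] and has the maximal width of [L] as its
    length, so [xi0 *m phi_w] is a diameter direction of [L]. Each diameter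
    direction not parallel to [xi0] is orthogonal to only one [w] (up to sign);
    by countability, for all but countably many [w] the rotation [phi_w] maps
    [xi0] to [xi0] or [- xi0], hence is the identity or minus the identity on
    [w^perp]. With the symmetry of [K] or [L] this gives
    [K | w^perp `<=` L | w^perp] for such [w]. A hyperplane strictly separating
    a point of [K] from the compact set [L] can be tilted slightly so that its
    normal is orthogonal to such a [w], which is a contradiction. *)

(** * Euclidean inner product and unit vectors *)

Lemma dotE (R : realType) n (x y : 'rV[R]_n) : dot x y = (x *m y^T) 0 0.
Proof. by rewrite mxE; apply: eq_bigr => i _; rewrite mxE. Qed.

Lemma dotC (R : realType) n (x y : 'rV[R]_n) : dot x y = dot y x.
Proof. by apply: eq_bigr => i _; rewrite mulrC. Qed.

Lemma dotDl (R : realType) n (x y z : 'rV[R]_n) :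
  dot (x + y) z = dot x z + dot y z.
Proof. by rewrite !dotE mulmxDl mxE. Qed.

Lemma dotZl (R : realType) n a (x y : 'rV[R]_n) : dot (a *: x) y = a * dot x y.
Proof. by rewrite !dotE -scalemxAl mxE. Qed.

Lemma dotNl (R : realType) n (x y : 'rV[R]_n) : dot (- x) y = - dot x y.
Proof. by rewrite -scaleN1r dotZl mulN1r. Qed.

Lemma dotDr (R : realType) n (x y z : 'rV[R]_n) :
  dot z (x + y) = dot z x + dot z y.
Proof. by rewrite dotC dotDl !(dotC z). Qed.

Lemma dotZr (R : realType) n a (x y : 'rV[R]_n) : dot y (a *: x) = a * dot y x.
Proof. by rewrite dotC dotZl dotC. Qed.

Lemma dotNr (R : realType) n (x y : 'rV[R]_n) : dot y (- x) = - dot y x.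
Proof. by rewrite dotC dotNl dotC. Qed.

Definition dotL := (dotDl, dotNl, dotZl, dotDr, dotNr, dotZr).

Lemma dot_ge0 (R : realType) n (x : 'rV[R]_n) : 0 <= dot x x.
Proof. by apply: sumr_ge0 => i _; rewrite -expr2 sqr_ge0. Qed.

Lemma dot_gt0 (R : realType) n (x : 'rV[R]_n) : x != 0 -> 0 < dot x x.
Proof.
rewrite lt_def dot_ge0 andbT; apply: contra => /eqP.
rewrite /dot => /psumr_eq0P h; apply/eqP/rowP => i; rewrite mxE.
have /eqP := h (fun i _ => ltac:(by rewrite -expr2 sqr_ge0)) i isT.
by rewrite mulf_eq0 orbb => /eqP.
Qed.

Lemma dot_mulmx_orthogonal (R : realType) n (A : 'M[R]_n) (x y : 'rV[R]_n) :
  A *m A^T = 1%:M -> dot (x *m A) (y *m A) = dot x y.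
Proof.
by move=> AA; rewrite !dotE trmx_mul mulmxA -(mulmxA x) AA mulmx1.
Qed.

Lemma sphereE (R : realType) n (x : 'rV[R]_n) : sphere x <-> dot x x = 1.
Proof.
rewrite /sphere /enorm /=; split=> [h|->]; last exact: sqrtr1.
by rewrite -(sqr_sqrtr (dot_ge0 x)) h expr1n.
Qed.

Lemma normalize_sphere (R : realType) n (x : 'rV[R]_n) :
  x != 0 -> sphere ((enorm x)^-1 *: x).
Proof.
move=> /dot_gt0 x0; apply/sphereE; rewrite !dotL /enorm.
rewrite mulrA -invfM -expr2 sqr_sqrtr ?ltW//.
by rewrite mulVf// gt_eqF.
Qed.

Lemma sphere_coord_le1 (R : realType) n (t : 'rV[R]_n) i :
  sphere t -> `|t 0 i| <= 1.
Proof.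
move=> /sphereE t1; rewrite -[1]sqrtr1 -sqrtr_sqr ler_wsqrtr// -t1.
rewrite /dot (bigD1 i)//= -expr2 lerDl.
by apply: sumr_ge0 => j _; rewrite -expr2 sqr_ge0.
Qed.

(** * Support and width functions of compact sets *)

(** Bounds the sets behind [support_fun] and [max_width], so that each [sup] dominates its
    elements. *)
Lemma compact_dot_bounded (R : realType) n (K : set 'rV[R]_n) : compact K ->
  exists B, forall t y, sphere t -> K y -> `|dot t y| <= B.
Proof.
move=> /compact_bounded[M [_ /(_ (M + 1) ltac:(by rewrite ltrDl)) MK]].
exists (\sum_(i < n) (M + 1)) => t y t1 Ky.
apply: (le_trans (ler_norm_sum _ _ _)); apply: ler_sum => i _.
rewrite normrM -[leRHS]mul1r ler_pM ?sphere_coord_le1//.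
apply: le_trans (MK _ Ky).
rewrite [`|y|]mx_normrE; apply: (le_bigmax _ (fun ij => `|y ij.1 ij.2|) (0, i)).
Qed.

Lemma support_fun_ge {R : realType} {n} {K : set 'rV[R]_n} (t y : 'rV[R]_n) :
  compact K -> sphere t -> K y -> dot t y <= support_fun K t.
Proof.
move=> /compact_dot_bounded[B hB] t1 Ky.
apply: ub_le_sup; last by exists y.
by exists B => _ [z Kz <-]; apply: (le_trans (ler_norm _)); exact: hB.
Qed.

Lemma sphereN (R : realType) n (t : 'rV[R]_n) : sphere t -> sphere (- t).
Proof. by rewrite !sphereE !dotL opprK. Qed.

Lemma width_ge (R : realType) n (K : set 'rV[R]_n) (t x y : 'rV[R]_n) :
  compact K -> sphere t -> K x -> K y -> dot t (x - y) <= width K t.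
Proof.
move=> cK t1 Kx Ky; rewrite !dotL; apply: lerD; first exact: support_fun_ge.
by rewrite -dotNl; apply: support_fun_ge => //; exact: sphereN.
Qed.

Lemma width_le_max (R : realType) n (K : set 'rV[R]_n) (t : 'rV[R]_n) :
  compact K -> K !=set0 -> sphere t -> width K t <= max_width K.
Proof.
move=> /compact_dot_bounded[B hB] K0 t1.
apply: ub_le_sup; last by exists t.
have hs u : sphere u -> support_fun K u <= B.
  move=> u1; apply: ge_sup; first by case: K0 => y Ky; exists (dot u y), y.
  by move=> _ [z Kz <-]; apply: (le_trans (ler_norm _)); exact: hB.
exists (B + B) => _ [u u1 <-]; apply: lerD; apply: hs => //; exact: sphereN.
Qed.

(** * Separation of a point from a compact convex set *)

Lemma continuous_dot (R : realType) n (a : 'rV[R]_n) :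
  continuous (fun y : 'rV[R]_n => dot (a - y) (a - y)).
Proof.
rewrite /dot; apply: continuous_big => [|i _ y]; first exact: add_continuous.
have h : (fun z : 'rV[R]_n => (a - z) 0 i) @ y --> (a - y) 0 i.
  rewrite !mxE; under eq_cvg do rewrite !mxE.
  have c : continuous (fun z : 'rV[R]_n => z 0 i) by exact: coord_continuous.
  exact: (cvgB (cvg_cst _) (c y)).
exact: (cvgM h h).
Qed.

Lemma convex_setP (R : realType) (M : lmodType R) (A : set M) (x y : M) t :
  convex_set A -> A x -> A y -> 0 <= t -> t <= 1 -> A (t *: x + (1 - t) *: y).
Proof.
move=> cA Ax Ay t0 t1.
exact/set_mem/(cA _ _ (Itv01 t0 t1) (mem_set Ax) (mem_set Ay)).
Qed.

(* The separating functional is [x - p] with [p] the point of [L] nearest to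
   [x]. *)
Lemma separation (R : realType) n (L : set 'rV[R]_n) (x : 'rV[R]_n) :
  compact L -> convex_set L -> L !=set0 -> ~ L x ->
  exists u e, 0 < e /\ forall y, L y -> e <= dot u (x - y).
Proof.
move=> cL vL L0 nLx.
have [|p /set_mem Lp pmin] :=
    @EVT_min_rV R n (fun y => dot (x - y) (x - y)) L L0 cL.
  by apply: continuous_subspaceT; exact: continuous_dot.
exists (x - p), (dot (x - p) (x - p)); split.
  by apply: dot_gt0; rewrite subr_eq0; apply/eqP => xp; apply: nLx; rewrite xp.
move=> y Ly.
suff h : dot (x - p) (y - p) <= 0.
  have -> : x - y = (x - p) - (y - p) by rewrite opprB addrA subrK.
  by rewrite (dotDr (x - p)) (dotNr (y - p)) lerDl oppr_ge0.
rewrite leNgt; apply/negP => h.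
set a := dot (x - p) (y - p) in h.
set b := dot (y - p) (y - p).
have b0 : 0 <= b := dot_ge0 _.
(* Moving from [p] to [p + t *: (y - p)] lowers the squared distance to [x] by
   [t * (2 * a - t * b)]; this [t] lies in ]0, 1] and makes the drop positive, against
   minimality. *)
pose t := a / (a + b).
have t0 : 0 < t by rewrite divr_gt0// ltr_wpDr.
have t1 : t <= 1 by rewrite ler_pdivrMr ?mul1r ?lerDl// ltr_wpDr.
have := pmin _ (mem_set (convex_setP vL Ly Lp (ltW t0) t1)).
have -> : t *: y + (1 - t) *: p = p + t *: (y - p).
  by rewrite scalerBl scale1r scalerBr addrCA.
rewrite opprD addrA; move: @a @b h b0 @t t0 t1.
move: (x - p) (y - p) => q r a b a0 b0 t t0 t1.
rewrite !dotL (dotC r q) -/a -/b => H.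
have : t * b < 2 * a.
  rewrite /t mulrAC ltr_pdivrMr ?ltr_wpDr//.
  by nra.
by nra.
Qed.

(** * Orthonormal frames and rotations about an axis *)

Lemma ex_unit_orthogonal (R : realType) (a b : 'rV[R]_3) :
  exists c, [/\ sphere c, dot a c = 0 & dot b c = 0].
Proof.
(* A 3 by 2 matrix has a nonzero left kernel, even for dependent [a] and [b]. *)
pose M := row_mx a^T b^T.
have : kermx M != 0.
  by rewrite kermx_eq0 /row_free neq_ltn ltnS rank_leq_col.
rewrite -submx0 => /row_subPn[i]; rewrite submx0 => c0.
have := row_sub i (kermx M); move: c0; set c := row i _ => c0 /sub_kermxP.
rewrite mul_mx_row -row_mx0 => /eq_row_mx[ca cb].
exists ((enorm c)^-1 *: c); split; first exact: normalize_sphere.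
  by rewrite dotZr dotC dotE ca mxE mulr0.
by rewrite dotZr dotC dotE cb mxE mulr0.
Qed.

Definition orthonormal3 (R : realType) (a b c : 'rV[R]_3) : Prop :=
  [/\ sphere a, sphere b & sphere c] /\
  [/\ dot a b = 0, dot a c = 0 & dot b c = 0].

Definition rows3 (R : realType) (a b c : 'rV[R]_3) : 'M[R]_3 :=
  \matrix_(i < 3) nth 0 [:: a; b; c] i.

Lemma rows3_orthogonal (R : realType) (a b c : 'rV[R]_3) :
  orthonormal3 a b c -> rows3 a b c *m (rows3 a b c)^T = 1%:M.
Proof.
move=> [[/sphereE aa /sphereE bb /sphereE cc] [ab ac bc]].
apply/matrixP => i j.
have -> : (rows3 a b c *m (rows3 a b c)^T) i j =
    dot (nth 0 [:: a; b; c] i) (nth 0 [:: a; b; c] j).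
  by rewrite mxE; apply: eq_bigr => k _; rewrite !mxE.
by rewrite mxE; case: i => [[|[|[|]]]//= ?]; case: j => [[|[|[|]]]//= ?];
  rewrite ?aa ?bb ?cc ?ab ?ac ?bc // dotC ?ab ?ac ?bc.
Qed.

(** For the square matrix [P = rows3 a b c], orthonormality of the rows also gives
    [P^T *m P = 1%:M], so [x = x *m P^T *m P]. *)
Lemma orthonormal3_expand (R : realType) (a b c x : 'rV[R]_3) :
  orthonormal3 a b c -> x = dot x a *: a + dot x b *: b + dot x c *: c.
Proof.
move=> /rows3_orthogonal/mulmx1C h; rewrite -[LHS]mulmx1 -h mulmxA.
rewrite mulmx_sum_row !big_ord_recl big_ord0 addr0 addrA !rowK.
by congr (_ *: _ + _ *: _ + _ *: _);
  rewrite mxE; apply: eq_bigr => k _; rewrite !mxE.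
Qed.

(* The determinant rules out reflections: [A] has matrix [diag e 1 f] in an
   orthonormal basis starting with [xi], [w], so [e * f = 1]. *)
Lemma SO2_scalar (R : realType) (w xi x : 'rV[R]_3) A e :
  SO2 w A -> sphere w -> sphere xi -> dot w xi = 0 ->
  xi *m A = e *: xi -> dot x w = 0 -> x *m A = e *: x.
Proof.
move=> [AA detA wA] w1 xi1 wxi xiA xw.
have [c [c1 xic wc]] := ex_unit_orthogonal xi w.
have on : orthonormal3 xi w c by split; split=> //; rewrite dotC.
have ee : e * e = 1.
  have := dot_mulmx_orthogonal xi xi AA.
  by rewrite xiA !dotL (proj1 (sphereE xi) xi1) mulr1.
(* [c *m A] is orthogonal to [w = w *m A] and to [xi = e *: (xi *m A)], which leaves only the line
   of [c]. *)
have cA : c *m A = dot (c *m A) c *: c.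
  rewrite {1}(orthonormal3_expand (c *m A) on).
  have -> : dot (c *m A) w = 0.
    by rewrite -{1}wA dot_mulmx_orthogonal// dotC.
  have -> : dot (c *m A) xi = 0.
    have -> : xi = e *: (xi *m A) by rewrite xiA scalerA ee scale1r.
    by rewrite dotZr dot_mulmx_orthogonal// dotC xic mulr0.
  by rewrite !scale0r !add0r.
set f := dot _ c in cA.
pose P := rows3 xi w c.
have PA : P *m A = diag_mx (\row_i nth 0 [:: e; 1; f] i) *m P.
  apply/row_matrixP => i.
  rewrite !row_mul row_diag_mx -scalemxAl -rowE rowK mxE.
  by case: i => [[|[|[|]]]//= ?]; rewrite ?scale1r.
have P0 : \det P != 0.
  have := congr1 determinant (rows3_orthogonal on).
  rewrite det_mulmx det1 => /eqP; apply: contraTneq => ->.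
  by rewrite mul0r eq_sym oner_eq0.
have ef : e * f = 1.
  move/(congr1 determinant): PA; rewrite !det_mulmx detA mulr1 det_diag.
  rewrite !big_ord_recl big_ord0 !mxE /= !mul1r mulr1 -{1}[\det P]mul1r.
  by move/(mulIf P0).
have fe : f = e by rewrite -[f]mul1r -ee -mulrA ef mulr1.
rewrite (orthonormal3_expand x on) xw scale0r addr0 mulmxDl -!scalemxAl.
by rewrite xiA cA fe scalerDr !scalerA !(mulrC e).
Qed.

(** * Countable exceptional sets, diameters and shadows *)

Lemma countable_avoid (R : realType) (D : set R) (d : R) :
  countable D -> 0 < d -> exists2 s, 0 < s < d & ~ D s.
Proof.
move=> cD d0; apply: contrapT => h.
(* Otherwise [D] would contain an interval of positive Lebesgue measure, whereas countable sets are
   null. *)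
have sub : `]0, d[%classic `<=` D.
  move=> s /=; rewrite in_itv /= => sd; apply: contrapT => nDs.
  by apply: h; exists s.
have := countable_lebesgue_measure0 (sub_countable (subset_card_le sub) cD).
by rewrite lebesgue_measure_itv /= lte_fin d0 sube0 => -[] /eqP; rewrite gt_eqF.
Qed.

(** [dot xi (z - y)] is the signed length of the diameter; its sign decides which endpoint is
    [p]. *)
Lemma diameter_dot (R : realType) n (K : set 'rV[R]_n) (xi z y : 'rV[R]_n) :
  sphere xi -> is_diameter K z y -> parallel (z - y) xi ->
  exists p q, [/\ K p, K q & dot xi (p - q) = max_width K].
Proof.
move=> /sphereE xi1 [segK zyM] [c zyc].
have Kz : K z.
  by apply: segK; exists 0; rewrite /= ?lexx ?ler01// subr0 scale1r scale0r addr0.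
have Ky : K y.
  by apply: segK; exists 1; rewrite /= ?lexx ?ler01// subrr scale1r scale0r add0r.
have cM : `|c| = max_width K.
  by rewrite -zyM /enorm zyc !dotL xi1 mulr1 -expr2 sqrtr_sqr.
case: (leP 0 c) => c0.
  by exists z, y; split => //; rewrite zyc dotZr xi1 mulr1 -cM ger0_norm.
exists y, z; split => //.
by rewrite -opprB dotNr zyc dotZr xi1 mulr1 -cM ltr0_norm.
Qed.

(** Inner products with [t] orthogonal to [w] do not see the projection, and [A] preserves both
    inner products and the plane orthogonal to [w]. *)
Lemma projection_image_dot (R : realType) (K L : set 'rV[R]_3) w A x :
  SO2 w A -> sphere w ->
  [set z *m A | z in projection K w] `<=` projection L w -> K x ->
  exists2 y, L y & forall t, dot t w = 0 -> dot (t *m A) y = dot t x.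
Proof.
move=> [AA _ wA] w1 sub Kx.
have [|y Ly xy] := sub ((x - dot x w *: w) *m A).
  by exists (x - dot x w *: w) => //; exists x.
exists y => // t tw.
have tAw : dot (t *m A) w = 0 by rewrite -{1}wA dot_mulmx_orthogonal.
have := congr1 (dot (t *m A)) xy; rewrite dot_mulmx_orthogonal//.
by rewrite !dotL tw tAw !mulr0 subr0 oppr0 addr0.
Qed.

(** The endpoints of the diameter yield two points of [L] whose difference has inner product
    [max_width L] with [xi *m A]; no width of [L] exceeds this. *)
Lemma SO2_diameter_direction (R : realType) (K L : set 'rV[R]_3) w A xi :
  compact L -> max_width K = max_width L -> sphere xi ->
  (exists z y, is_diameter K z y /\ parallel (z - y) xi) ->
  sphere w -> dot w xi = 0 -> SO2 w A ->
  [set z *m A | z in projection K w] `<=` projection L w ->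
  diameter_directions L (xi *m A).
Proof.
move=> cL KL xi1 [z [y [zyd zyp]]] w1 wxi wA sub.
have [p [q [Kp Kq pq]]] := diameter_dot xi1 zyd zyp.
have [p' Lp' p'E] := projection_image_dot wA w1 sub Kp.
have [q' Lq' q'E] := projection_image_dot wA w1 sub Kq.
have xiw : dot xi w = 0 by rewrite dotC.
have xiA1 : sphere (xi *m A).
  by apply/sphereE; case: wA => AA _ _; rewrite dot_mulmx_orthogonal//; apply/sphereE.
split=> //; apply/le_anti/andP; split.
  by apply: width_le_max => //; exists p'.
rewrite -KL -pq !dotL -p'E// -q'E// -dotNr -dotDr.
exact: width_ge.
Qed.

(* The directions of the pencil [w0 + s *: v] orthogonal to a given [d] outside
   the line of [xi] form a single value of [s], so all but countably many [s]
   avoid all diameter directions other than those of [xi]. *)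
Lemma generic_direction (R : realType) (D : set 'rV[R]_3) (xi w0 v : 'rV[R]_3)
    (delta : R) :
  orthonormal3 xi w0 v -> countable D -> 0 < delta ->
  exists2 s, 0 < s < delta &
    forall d, D d -> dot d (w0 + s *: v) = 0 -> d = dot d xi *: xi.
Proof.
move=> on cD delta0.
(* The only [s] with [d] orthogonal to [w0 + s *: v], provided [dot d v] is nonzero. *)
pose f d := - dot d w0 / dot d v.
have [|s sd nDs] := @countable_avoid R (f @` D) delta _ delta0.
  exact: card_le_trans (card_image_le _ _) cD.
exists s => // d Dd; rewrite !dotL => dW.
have dv : dot d v = 0.
  apply: contrapT => /eqP dv; apply: nDs; exists d => //.
  have -> : f d = - dot d w0 / dot d v by [].
  by rewrite (_ : - dot d w0 = s * dot d v) ?mulfK//; lra.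
have dw0 : dot d w0 = 0 by rewrite dv mulr0 addr0 in dW.
by rewrite {1}(orthonormal3_expand d on) dv dw0 !scale0r !addr0.
Qed.

(** * Tilting the separating hyperplane *)

Unset Implicit Arguments.

Theorem theorem3 (R : realType) (K L : set 'rV[R]_3)
  (hK : convex_body K) (hL : convex_body L)
  (hKc : countable (diameter_directions K))
  (hLc : countable (diameter_directions L))
  (hlen : max_width K = max_width L)
  (xi0 : 'rV[R]_3) (hxi0 : sphere xi0)
  (hd : exists z y : 'rV[R]_3, is_diameter K z y /\ parallel (z - y) xi0)
  (hproj : forall w : 'rV[R]_3, sphere w -> dot w xi0 = 0 ->
    exists2 phi : 'M[R]_3, SO2 w phi &
      [set x *m phi | x in projection K w] `<=` projection L w)
  (hsym : origin_symmetric K \/ origin_symmetric L) :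
  K `<=` L.
Proof.
move=> x Kx; apply: contrapT => nLx.
have [cK _ _] := hK; have [cL vL [l0 /interior_subset Ll0]] := hL.
have L0 : L !=set0 by exists l0.
have [u [gap [gap0 hu]]] := separation cL vL L0 nLx.
have [w0 [w01 xiw0 uw0]] := ex_unit_orthogonal xi0 u.
have [v [v1 xiv w0v]] := ex_unit_orthogonal xi0 w0.
have on : orthonormal3 xi0 w0 v by [].
have [BK hBK] := compact_dot_bounded cK.
have [BL hBL] := compact_dot_bounded cL.
pose B := `|BK| + `|BL|.
have den0 : 0 < 1 + `|dot u v| * B by rewrite ltr_pwDl// mulr_ge0// addr_ge0.
(* This range of [s] keeps [s] times the absolute value of [dot u v] times [B] below [gap]; the
   summand 1 keeps the denominator positive. *)
have [|s /andP[s0 sdelta] sgen] :=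
    generic_direction (delta := gap / (1 + `|dot u v| * B)) on hLc.
  by rewrite divr_gt0.
pose W := w0 + s *: v.
have WW : dot W W = 1 + s ^+ 2.
  move/sphereE: w01; move/sphereE: v1 => v1 w01.
  by rewrite /W !dotL w01 v1 (dotC v) w0v; ring.
pose k := (enorm W)^-1.
pose w := k *: W.
have W1 : 1 <= enorm W.
  by rewrite -[leLHS]sqrtr1 ler_wsqrtr// WW lerDl sqr_ge0.
have k0 : 0 < k by rewrite invr_gt0 (lt_le_trans ltr01).
have k1 : k <= 1 by rewrite invf_le1// (lt_le_trans ltr01).
have w1 : sphere w.
  apply: normalize_sphere; apply: contraTneq W1 => ->.
  by rewrite /enorm -(scale0r (0 : 'rV[R]_3)) dotZl mul0r sqrtr0 ler10.
have wxi : dot w xi0 = 0.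
  by rewrite !dotL (dotC w0) (dotC v) xiw0 xiv; ring.
have [A wA sub] := hproj w w1 wxi.
have [AA _ wAw] := wA.
have DA := SO2_diameter_direction cL hlen hxi0 hd w1 wxi wA sub.
(* The rotated [xi0] is a diameter direction of [L] orthogonal to [W], so the choice of [s] puts it
   on the line of [xi0]. *)
have xiA : xi0 *m A = dot (xi0 *m A) xi0 *: xi0.
  apply: sgen => //.
  have : dot (xi0 *m A) w = 0 by rewrite -wAw dot_mulmx_orthogonal// dotC.
  by rewrite dotZr => /eqP; rewrite mulf_eq0 gt_eqF//= => /eqP.
set e := dot _ xi0 in xiA.
have e1 : e = 1 \/ e = -1.
  have := dot_mulmx_orthogonal xi0 xi0 AA.
  rewrite xiA !dotL (proj1 (sphereE _) hxi0) mulr1 -expr2 => /eqP.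
  by rewrite sqrf_eq1 => /orP[] /eqP; [left|right].
(* Shadows only control functionals orthogonal to [w], so [u] is replaced by its component there. *)
pose us := u - dot u w *: w.
have usw : dot us w = 0.
  rewrite dotDl dotNl (dotZl (dot u w) w w) (proj1 (sphereE w) w1).
  by rewrite mulr1 subrr.
have usA : us *m A = e *: us := SO2_scalar wA w1 hxi0 wxi xiA usw.
have shadow x' : K x' -> exists2 y, L y & e * dot us y = dot us x'.
  move=> /(projection_image_dot wA w1 sub)[y Ly hy].
  by exists y => //; rewrite -hy// usA dotZl.
have [y Ly usy] : exists2 y, L y & dot us y = dot us x.
  (* For [e = -1] the sign is absorbed by using [- x] when [K] is symmetric, and [- y] when [L]
     is. *)
  case: e1 => e1; move: shadow; rewrite e1 => shadow.
    by have [y Ly] := shadow x Kx; rewrite mul1r; exists y.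
  have Nsym (M : set 'rV[R]_3) z : origin_symmetric M -> M z -> M (- z).
    by move=> symM Mz; rewrite symM; exists z.
  case: hsym => sym.
    have [y Ly] := shadow _ (Nsym _ _ sym Kx).
    by rewrite mulN1r dotNr => /oppr_inj; exists y.
  have [y Ly] := shadow x Kx; rewrite mulN1r -dotNr.
  by exists (- y) => //; exact: Nsym.
(* Hence [dot u (x - y) = dot u w * dot w (x - y)]. As [w0] is orthogonal to [u], the first factor
   is of order [s], and the product falls below [gap]. *)
have : dot us (x - y) = 0 by rewrite dotDr dotNr usy subrr.
rewrite dotDl dotNl dotZl => /eqP; apply/negP; rewrite subr_eq0.
apply/eqP => uxy.
have := hu y Ly; rewrite uxy; apply/negP; rewrite -ltNge.
apply: (le_lt_trans (ler_norm _)); rewrite normrM.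
have uw : `|dot u w| <= s * `|dot u v|.
  rewrite !dotL uw0 add0r !normrM (gtr0_norm k0) (gtr0_norm s0).
  by rewrite ler_piMl// mulr_ge0// ltW.
have wxy : `|dot w (x - y)| <= B.
  rewrite dotDr dotNr; apply: (le_trans (ler_normB _ _)); apply: lerD.
    exact: le_trans (hBK _ _ w1 Kx) (ler_norm _).
  exact: le_trans (hBL _ _ w1 Ly) (ler_norm _).
apply: (le_lt_trans (ler_pM _ _ uw wxy)) => //.
rewrite ltr_pdivlMr// mulrDr mulr1 in sdelta.
by rewrite -mulrA; lra.
Qed.
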